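(* For a Markov category $\mathsf{C}$, the following are equivalent: 1. $\mathsf{C}$ is representable. 2. There is an affine symmetric monoidal monad $P$ on $\mathsf{C}_{\det}$, with unit $\delta$ and lax monoidal structure maps $\nabla_{X,Y}\colon PX\otimes PY\to P(X\otimes Y)$, such that: (a) for every object $X$, the commutative square in $\mathsf{C}_{\det}$ $$\nabla_{X,X}\circ(\delta_X,\delta_X)=P(\mathrm{id}_X,\mathrm{id}_X)\circ\delta_X\colon X\to P(X\otimes X)$$ with legs $\delta_X\colon X\to PX$ and $(\delta_X,\delta_X)\colon X\to PX\otimes PX$, is a pullback of $P(\mathrm{id}_X,\mathrm{id}_X)\colon PX\to P(X\otimes X)$ and $\nabla_{X,X}\colon PX\otimes PX\to P(X\otimes X)$; (b) the identity functor on $\mathsf{C}_{\det}$ extends to an isomorphism of Markov categories $\mathsf{C}\cong\mathrm{Kl}(P)$.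
   Context: Coherence isomorphisms of monoidal categories are suppressed. A Markov category is a symmetric monoidal category $(\mathsf{C},\otimes,I)$ whose unit $I$ is terminal (write $\mathrm{del}_X \colon X \to I$), in which every object $X$ carries a distinguished morphism $\mathrm{copy}_X \colon X \to X\otimes X$ making $(X,\mathrm{copy}_X,\mathrm{del}_X)$ a commutative comonoid, and such that $\mathrm{copy}_{X\otimes Y} = (\mathrm{id}_X\otimes \mathrm{swap}_{X,Y}\otimes \mathrm{id}_Y)\circ(\mathrm{copy}_X\otimes \mathrm{copy}_Y)$. A morphism $f\colon X\to Y$ is deterministic if $\mathrm{copy}_Y\circ f=(f\otimes f)\circ \mathrm{copy}_X$. Deterministic morphisms form a subcategory $\mathsf{C}_{\det}$ with the same objects, which is cartesian monoidal with respect to the monoidal structure inherited from $\mathsf{C}$, and with diagonals $(\mathrm{id}_X,\mathrm{id}_X)=\mathrm{copy}_X$. $\mathsf{C}$ is representable if every object $X$ has a distribution object, i.e. an object $PX$ with a morphism $\mathrm{samp}_X\colon PX\to X$ in $\mathsf{C}$ such that $\mathrm{samp}_X\circ -\colon \mathsf{C}_{\det}(A,PX)\to\mathsf{C}(A,X)$ is a bijection for all objects $A$. A symmetric monoidal monad on a cartesian monoidal category $\mathsf{D}$ is a monad $(P,E,\delta)$ (multiplication $E$, unit $\delta$) where $P$ is a symmetric lax monoidal functor, with structure maps $\nabla_{X,Y}\colon PX\times PY\to P(X\times Y)$, and $E,\delta$ are monoidal natural transformations; it is affine if $P(I)\cong I$ for the terminal object $I$. The Kleisli category $\mathrm{Kl}(P)$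 is then a Markov category: the monoidal product on objects is the product of $\mathsf{D}$, the monoidal product of Kleisli morphisms represented by $f\colon A\to PX$ and $g\colon B\to PY$ is represented by $\nabla\circ(f\times g)$, and $\mathrm{copy}_X$ is represented by $\delta_{X\times X}\circ(\mathrm{id}_X,\mathrm{id}_X)\colon X\to P(X\times X)$. There is a canonical identity-on-objects functor $\mathsf{D}\to\mathrm{Kl}(P)$, sending $f\colon X \to Y$ to the Kleisli morphism represented by $\delta_Y\circ f$. An isomorphism of Markov categories is an isomorphism of symmetric monoidal categories taking copy morphisms to copy morphisms. ''Extends'' in (b) means that the isomorphism $\mathsf{C}\to\mathrm{Kl}(P)$ restricts on $\mathsf{C}_{\det}$ to the canonical functor $\mathsf{C}_{\det}\to\mathrm{Kl}(P)$. *)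

(* Defs.v *)
From mathcomp Require Import ssreflect ssrfun ssrbool.
From Stdlib Require Import ProofIrrelevance.

Set Implicit Arguments.
Unset Strict Implicit.
Unset Printing Implicit Defensive.

Declare Scope cat_scope.
Delimit Scope cat_scope with cat.
Local Open Scope cat_scope.

Reserved Notation "g ∘ f" (at level 39, right associativity).
Reserved Notation "X ⊗ Y" (at level 38, left associativity).
Reserved Notation "f ⊗₁ g" (at level 38, left associativity).

Record Category := {
  ob :> Type;
  hom : ob -> ob -> Type;
  idm : forall X, hom X X;
  comp : forall X Y Z, hom Y Z -> hom X Y -> hom X Z;
  comp1m : forall X Y (f : hom X Y), comp (idm Y) f = f;
  compm1 : forall X Y (f : hom X Y), comp f (idm X) = f;
  compA : forall W X Y Z (h : hom Y Z) (g : hom X Y) (f : hom W X),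
    comp h (comp g f) = comp (comp h g) f }.

Arguments hom {c} X Y.
Arguments idm {c} X.
Arguments comp {c X Y Z} g f.
Notation "g ∘ f" := (comp g f) : cat_scope.

Section Category_lemmas.
Variable C : Category.
Implicit Types X Y Z W : C.

Lemma compk X Y Z (g : hom Y Z) (f : hom X Y) (h : hom X Z) :
  g ∘ f = h -> forall W (k : hom W X), g ∘ f ∘ k = h ∘ k.
Proof. by move=> <- W k; rewrite compA. Qed.

Lemma cancel_l X Y Z (i : hom Y Z) (j : hom Z Y) (f g : hom X Y) :
  j ∘ i = idm Y -> i ∘ f = i ∘ g -> f = g.
Proof. by move=> ji e; rewrite -(comp1m f) -ji -compA e compA ji comp1m. Qed.

Lemma cancel_r X Y Z (i : hom X Y) (j : hom Y X) (f g : hom Y Z) :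
  i ∘ j = idm Y -> f ∘ i = g ∘ i -> f = g.
Proof. by move=> ij e; rewrite -(compm1 f) -ij compA e -compA ij compm1. Qed.

End Category_lemmas.

Definition isomorphic (C : Category) (X Y : C) : Prop :=
  exists (f : hom X Y) (g : hom Y X), g ∘ f = idm X /\ f ∘ g = idm Y.

Definition is_pullback (C : Category) (X Y Z W : C)
    (f : hom X Z) (g : hom Y Z) (p : hom W X) (q : hom W Y) : Prop :=
  f ∘ p = g ∘ q /\
  forall (A : C) (a : hom A X) (b : hom A Y), f ∘ a = g ∘ b ->
    exists! u : hom A W, p ∘ u = a /\ q ∘ u = b.

Record Functor (C D : Category) := {
  fob :> C -> D;
  fmap : forall X Y, hom X Y -> hom (fob X) (fob Y);
  fmap1 : forall X, fmap (idm X) = idm (fob X);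
  fmapM : forall X Y Z (g : hom Y Z) (f : hom X Y),
    fmap (g ∘ f) = fmap g ∘ fmap f }.

Arguments fmap {C D} _ {X Y} _.

Definition functor_id (C : Category) : Functor C C.
Proof. by exists (fun X => X) (fun X Y f => f). Defined.

Definition functor_comp (C D E : Category) (G : Functor D E) (F : Functor C D) :
  Functor C E.
Proof.
exists (fun X => G (F X)) (fun X Y f => fmap G (fmap F f)).
- by move=> X; rewrite !fmap1.
- by move=> X Y Z g f; rewrite !fmapM.
Defined.

(** The set of all arrows of a category: [arr f = arr g] says that [f] and [g]
    are equal, including their domains and codomains, when these are not
    syntactically the same. *)
Record Arrow (C : Category) := arr { dom : C; cod : C; mor : hom dom cod }.
Arguments arr {C dom cod} mor.

Definition functor_eq (C D : Category) (F G : Functor C D) : Prop :=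
  forall (X Y : C) (f : hom X Y), arr (fmap F f) = arr (fmap G f).

Record SymMonCat := {
  smc_cat :> Category;
  unit_ob : smc_cat;
  tens : smc_cat -> smc_cat -> smc_cat;
  tensm : forall X Y X' Y' : smc_cat,
    hom X X' -> hom Y Y' -> hom (tens X Y) (tens X' Y');
  assoc : forall X Y Z, hom (tens (tens X Y) Z) (tens X (tens Y Z));
  associ : forall X Y Z, hom (tens X (tens Y Z)) (tens (tens X Y) Z);
  lunit : forall X, hom (tens unit_ob X) X;
  luniti : forall X, hom X (tens unit_ob X);
  runit : forall X, hom (tens X unit_ob) X;
  runiti : forall X, hom X (tens X unit_ob);
  swap : forall X Y, hom (tens X Y) (tens Y X);
  tensm1 : forall X Y, tensm (idm X) (idm Y) = idm (tens X Y);
  tensmM : forall X Y X' Y' X'' Y'' (g : hom X' X'') (f : hom X X')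
      (g' : hom Y' Y'') (f' : hom Y Y'),
    tensm (g ∘ f) (g' ∘ f') = tensm g g' ∘ tensm f f';
  assocK : forall X Y Z, associ X Y Z ∘ assoc X Y Z = idm _;
  associK : forall X Y Z, assoc X Y Z ∘ associ X Y Z = idm _;
  lunitK : forall X, luniti X ∘ lunit X = idm _;
  lunitiK : forall X, lunit X ∘ luniti X = idm _;
  runitK : forall X, runiti X ∘ runit X = idm _;
  runitiK : forall X, runit X ∘ runiti X = idm _;
  swapK : forall X Y, swap Y X ∘ swap X Y = idm _;
  assoc_nat : forall X Y Z X' Y' Z' (f : hom X X') (g : hom Y Y') (h : hom Z Z'),
    assoc X' Y' Z' ∘ tensm (tensm f g) h = tensm f (tensm g h) ∘ assoc X Y Z;
  lunit_nat : forall X Y (f : hom X Y),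
    lunit Y ∘ tensm (idm unit_ob) f = f ∘ lunit X;
  runit_nat : forall X Y (f : hom X Y),
    runit Y ∘ tensm f (idm unit_ob) = f ∘ runit X;
  swap_nat : forall X Y X' Y' (f : hom X X') (g : hom Y Y'),
    swap X' Y' ∘ tensm f g = tensm g f ∘ swap X Y;
  pentagon : forall W X Y Z,
    tensm (idm W) (assoc X Y Z) ∘ assoc W (tens X Y) Z
      ∘ tensm (assoc W X Y) (idm Z)
    = assoc W X (tens Y Z) ∘ assoc (tens W X) Y Z;
  triangle : forall X Y,
    tensm (idm X) (lunit Y) ∘ assoc X unit_ob Y = tensm (runit X) (idm Y);
  hexagon : forall X Y Z,
    assoc Y Z X ∘ swap X (tens Y Z) ∘ assoc X Y Z
    = tensm (idm Y) (swap X Z) ∘ assoc Y X Z ∘ tensm (swap X Y) (idm Z) }.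

Arguments unit_ob {s}.
Arguments tens {s} X Y.
Arguments tensm {s X Y X' Y'} f g.
Arguments assoc {s} X Y Z.
Arguments associ {s} X Y Z.
Arguments lunit {s} X.
Arguments luniti {s} X.
Arguments runit {s} X.
Arguments runiti {s} X.
Arguments swap {s} X Y.
Notation "X ⊗ Y" := (tens X Y) : cat_scope.
Notation "f ⊗₁ g" := (tensm f g) : cat_scope.

(** The map written [id ⊗ swap ⊗ id] when coherence isomorphisms are
    suppressed. *)
Definition interchange (M : SymMonCat) (X X' Y Y' : M) :
    hom ((X ⊗ X') ⊗ (Y ⊗ Y')) ((X ⊗ Y) ⊗ (X' ⊗ Y')) :=
  associ X Y (X' ⊗ Y')
  ∘ (idm X ⊗₁ (assoc Y X' Y' ∘ (swap X' Y ⊗₁ idm Y') ∘ associ X' Y Y'))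
  ∘ assoc X X' (Y ⊗ Y').

(** As coherence isomorphisms are suppressed, symmetric monoidal functors are
    required to preserve the structure on the nose. *)
Record StrictSMFunctor (M N : SymMonCat) := {
  ssm_functor :> Functor M N;
  ssm_unit : ssm_functor unit_ob = unit_ob;
  ssm_tens : forall X Y, ssm_functor (X ⊗ Y) = ssm_functor X ⊗ ssm_functor Y;
  ssm_tensm : forall (X Y X' Y' : M) (f : hom X X') (g : hom Y Y'),
    arr (fmap ssm_functor (f ⊗₁ g))
    = arr (fmap ssm_functor f ⊗₁ fmap ssm_functor g);
  ssm_assoc : forall X Y Z : M, arr (fmap ssm_functor (assoc X Y Z))
    = arr (assoc (ssm_functor X) (ssm_functor Y) (ssm_functor Z));
  ssm_lunit : forall X : M,
    arr (fmap ssm_functor (lunit X)) = arr (lunit (ssm_functor X));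
  ssm_runit : forall X : M,
    arr (fmap ssm_functor (runit X)) = arr (runit (ssm_functor X));
  ssm_swap : forall X Y : M, arr (fmap ssm_functor (swap X Y))
    = arr (swap (ssm_functor X) (ssm_functor Y)) }.

Section Coherence.
Variable M : SymMonCat.
Implicit Types A B W X Y Z : M.
Local Notation I := (@unit_ob M).

Lemma tensm1M X Y Z W (g : hom Y Z) (f : hom X Y) :
  idm W ⊗₁ (g ∘ f) = (idm W ⊗₁ g) ∘ (idm W ⊗₁ f).
Proof. by rewrite -tensmM comp1m. Qed.

Lemma tensmM1 X Y Z W (g : hom Y Z) (f : hom X Y) :
  (g ∘ f) ⊗₁ idm W = (g ⊗₁ idm W) ∘ (f ⊗₁ idm W).
Proof. by rewrite -tensmM comp1m. Qed.

Lemma tensm_lr X Y X' Y' (f : hom X X') (g : hom Y Y') :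
  f ⊗₁ g = (f ⊗₁ idm Y') ∘ (idm X ⊗₁ g).
Proof. by rewrite -tensmM comp1m compm1. Qed.

Lemma tensm_rl X Y X' Y' (f : hom X X') (g : hom Y Y') :
  f ⊗₁ g = (idm X' ⊗₁ g) ∘ (f ⊗₁ idm Y).
Proof. by rewrite -tensmM comp1m compm1. Qed.

Lemma tensm_inv X Y X' Y' (f : hom X X') (f' : hom X' X) (g : hom Y Y')
    (g' : hom Y' Y) :
  f' ∘ f = idm X -> g' ∘ g = idm Y -> (f' ⊗₁ g') ∘ (f ⊗₁ g) = idm _.
Proof. by move=> ef eg; rewrite -tensmM ef eg tensm1. Qed.

Lemma associ_nat X Y Z X' Y' Z' (f : hom X X') (g : hom Y Y') (h : hom Z Z') :
  associ X' Y' Z' ∘ (f ⊗₁ (g ⊗₁ h)) = ((f ⊗₁ g) ⊗₁ h) ∘ associ X Y Z.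
Proof.
apply: (cancel_l (assocK _ _ _)).
by rewrite compA associK comp1m compA assoc_nat -compA associK compm1.
Qed.

Lemma assoc_nat_l X X' Y Z (f : hom X X') :
  assoc X' Y Z ∘ ((f ⊗₁ idm Y) ⊗₁ idm Z) = (f ⊗₁ idm _) ∘ assoc X Y Z.
Proof. by rewrite assoc_nat tensm1. Qed.

Lemma assoc_nat_m X Y Y' Z (f : hom Y Y') :
  assoc X Y' Z ∘ ((idm X ⊗₁ f) ⊗₁ idm Z)
  = (idm X ⊗₁ (f ⊗₁ idm Z)) ∘ assoc X Y Z.
Proof. by rewrite assoc_nat. Qed.

Lemma assoc_nat_r X Y Z Z' (f : hom Z Z') :
  assoc X Y Z' ∘ (idm _ ⊗₁ f) = (idm X ⊗₁ (idm Y ⊗₁ f)) ∘ assoc X Y Z.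
Proof. by rewrite -assoc_nat tensm1. Qed.

Lemma whisker_l_inj X Y (f g : hom X Y) : idm I ⊗₁ f = idm I ⊗₁ g -> f = g.
Proof.
move=> e; apply: (cancel_r (lunitiK X)).
by rewrite -!lunit_nat e.
Qed.

Lemma whisker_r_inj X Y (f g : hom X Y) : f ⊗₁ idm I = g ⊗₁ idm I -> f = g.
Proof.
move=> e; apply: (cancel_r (runitiK X)).
by rewrite -!runit_nat e.
Qed.

Lemma lunit_tens X Y : lunit (X ⊗ Y) ∘ assoc I X Y = lunit X ⊗₁ idm Y.
Proof.
apply: whisker_l_inj.
have inv : (assoc I (I ⊗ X) Y ∘ (assoc I I X ⊗₁ idm Y))
    ∘ ((associ I I X ⊗₁ idm Y) ∘ associ I (I ⊗ X) Y) = idm _.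
  by rewrite -compA (compk (tensm_inv (associK _ _ _) (comp1m _))) comp1m associK.
apply: (cancel_r inv).
rewrite tensm1M -compA pentagon compA triangle.
rewrite [RHS]compA -assoc_nat -compA -tensmM triangle comp1m.
by rewrite assoc_nat tensm1.
Qed.

Lemma runit_tens X Y : (idm X ⊗₁ runit Y) ∘ assoc X Y I = runit (X ⊗ Y).
Proof.
apply: whisker_r_inj; apply: (cancel_l (assocK _ _ _)).
rewrite tensmM1 compA assoc_nat -triangle tensm1M -!compA pentagon.
by rewrite -triangle [RHS]compA -tensm1 assoc_nat -compA.
Qed.

Lemma swap_lunit X : lunit X ∘ swap X I = runit X.
Proof.
apply: whisker_r_inj.
have := f_equal (fun k => lunit (I ⊗ X) ∘ k) (hexagon X I I).
rewrite (compk (lunit_tens _ _)) (compA (lunit _ ⊗₁ _)) -swap_nat -compA triangle.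
rewrite (compk (lunit_nat _)) -compA (compk (lunit_tens _ _)) -tensmM comp1m.
by move/(cancel_l (swapK _ _)) => <-.
Qed.

Lemma swap_runit X : runit X ∘ swap I X = lunit X.
Proof. by rewrite -swap_lunit -compA swapK compm1. Qed.

(** Locked, so that rewriting with [compA] does not unfold them. *)
Definition slide X Y W : hom (X ⊗ (Y ⊗ W)) (Y ⊗ (X ⊗ W)) :=
  locked (assoc Y X W ∘ (swap X Y ⊗₁ idm W) ∘ associ X Y W).

Lemma slideE X Y W :
  slide X Y W = assoc Y X W ∘ (swap X Y ⊗₁ idm W) ∘ associ X Y W.
Proof. by rewrite /slide -lock. Qed.

Definition ichg X X' Y Y' : hom ((X ⊗ X') ⊗ (Y ⊗ Y')) ((X ⊗ Y) ⊗ (X' ⊗ Y')) :=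
  locked (interchange X X' Y Y').

Lemma ichgE X X' Y Y' : ichg X X' Y Y' = interchange X X' Y Y'.
Proof. by rewrite /ichg -lock. Qed.

Lemma ichg_slide X X' Y Y' :
  ichg X X' Y Y'
  = associ X Y (X' ⊗ Y') ∘ (idm X ⊗₁ slide X' Y Y') ∘ assoc X X' (Y ⊗ Y').
Proof. by rewrite ichgE slideE. Qed.

Lemma slide_nat X Y W X' Y' W' (f : hom X X') (g : hom Y Y') (h : hom W W') :
  slide X' Y' W' ∘ (f ⊗₁ (g ⊗₁ h)) = (g ⊗₁ (f ⊗₁ h)) ∘ slide X Y W.
Proof.
rewrite !slideE -!compA associ_nat (compA (swap _ _ ⊗₁ _)) -tensmM swap_nat.
by rewrite comp1m -{1}(compm1 h) tensmM !compA assoc_nat.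
Qed.

Lemma slideK X Y W : slide Y X W ∘ slide X Y W = idm _.
Proof.
rewrite !slideE -!compA (compk (assocK _ _ _)) comp1m.
by rewrite (compk (tensm_inv (swapK _ _) (comp1m _))) comp1m associK.
Qed.

Lemma slide_assoc X Y W :
  slide X Y W ∘ assoc X Y W = assoc Y X W ∘ (swap X Y ⊗₁ idm W).
Proof. by rewrite !slideE -!compA assocK compm1. Qed.

Lemma pentagon_r W X Y Z :
  assoc W X (Y ⊗ Z) ∘ assoc (W ⊗ X) Y Z ∘ (associ W X Y ⊗₁ idm Z)
  = (idm W ⊗₁ assoc X Y Z) ∘ assoc W (X ⊗ Y) Z.
Proof.
rewrite compA -pentagon -!compA (tensm_inv (associK _ _ _) (comp1m _)).
by rewrite compm1.
Qed.

Lemma slide_tens_r X Y Z W :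
  assoc Y Z (X ⊗ W) ∘ slide X (Y ⊗ Z) W
  = (idm Y ⊗₁ slide X Z W) ∘ slide X Y (Z ⊗ W) ∘ (idm X ⊗₁ assoc Y Z W).
Proof.
have inv : (assoc X (Y ⊗ Z) W ∘ (assoc X Y Z ⊗₁ idm W))
    ∘ ((associ X Y Z ⊗₁ idm W) ∘ associ X (Y ⊗ Z) W) = idm _.
  by rewrite -compA (compk (tensm_inv (associK _ _ _) (comp1m _))) comp1m associK.
apply: (cancel_r inv).
rewrite -!compA.
rewrite pentagon (compk (slide_assoc _ _ _)) -!compA.
rewrite (compk (slide_assoc _ _ _)) -!compA.
rewrite -assoc_nat_l.
rewrite (compA (assoc Y Z _)) -pentagon -!compA -!tensmM1 hexagon !tensmM1.
rewrite [in RHS](compA (assoc Y X _)) -pentagon -!compA.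
rewrite [in RHS](compA (idm Y ⊗₁ _)) -tensm1M slide_assoc tensm1M -!compA.
by congr (_ ∘ _); rewrite !compA assoc_nat.
Qed.

Lemma slide_tens_l X Y Z W :
  (idm Z ⊗₁ assoc X Y W) ∘ slide (X ⊗ Y) Z W
  = slide X Z (Y ⊗ W) ∘ (idm X ⊗₁ slide Y Z W) ∘ assoc X Y (Z ⊗ W).
Proof.
apply: (cancel_l (slideK Z X _)).
rewrite (compk (slideK _ _ _)) comp1m.
apply: (@cancel_l _ _ _ _ (idm X ⊗₁ slide Z Y W) (idm X ⊗₁ slide Y Z W)).
  by rewrite -tensm1M slideK tensm1.
rewrite [RHS](compk (tensm_inv (comp1m _) (slideK _ _ _))) comp1m.
rewrite (compA (slide _ _ _)) compA -slide_tens_r -compA slideK compm1 //.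
Qed.

Lemma slide_whisker X Y Y' W :
  (idm Y ⊗₁ assoc X Y' W) ∘ assoc Y (X ⊗ Y') W ∘ (slide X Y Y' ⊗₁ idm W)
  = slide X Y (Y' ⊗ W) ∘ (idm X ⊗₁ assoc Y Y' W) ∘ assoc X (Y ⊗ Y') W.
Proof.
rewrite !slideE !tensmM1 (compA (assoc _ _ _)) (compA (idm Y ⊗₁ _)).
rewrite pentagon -!compA (compk (assoc_nat_l _ _ _)) -!compA.
congr (_ ∘ _ ∘ _).
apply: (cancel_l (assocK _ _ _)).
by rewrite pentagon_r compA associK comp1m.
Qed.

Lemma ichg_assoc X X' Y Y' :
  assoc X Y (X' ⊗ Y') ∘ ichg X X' Y Y'
  = (idm X ⊗₁ slide X' Y Y') ∘ assoc X X' (Y ⊗ Y').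
Proof. by rewrite !ichg_slide compA associK comp1m. Qed.

Definition unfold4 X X' Y Y' W :
    hom (((X ⊗ X') ⊗ (Y ⊗ Y')) ⊗ W) (X ⊗ (X' ⊗ (Y ⊗ (Y' ⊗ W)))) :=
  locked (assoc X X' _ ∘ (idm _ ⊗₁ assoc Y Y' W)
    ∘ assoc (X ⊗ X') (Y ⊗ Y') W).

Lemma unfold4E X X' Y Y' W :
  unfold4 X X' Y Y' W = assoc X X' _ ∘ (idm _ ⊗₁ assoc Y Y' W)
    ∘ assoc (X ⊗ X') (Y ⊗ Y') W.
Proof. by rewrite /unfold4 -lock. Qed.

Lemma unfold4_inj X X' Y Y' W Z (f g : hom Z (((X ⊗ X') ⊗ (Y ⊗ Y')) ⊗ W)) :
  unfold4 X X' Y Y' W ∘ f = unfold4 X X' Y Y' W ∘ g -> f = g.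
Proof.
rewrite !unfold4E -!compA => /(cancel_l (assocK _ _ _)).
move/(cancel_l (tensm_inv (comp1m _) (assocK _ _ _))).
by move/(cancel_l (assocK _ _ _)).
Qed.

Lemma ichg_whisker X X' Y Y' W :
  unfold4 X Y X' Y' W ∘ (ichg X X' Y Y' ⊗₁ idm W)
  = (idm X ⊗₁ slide X' Y (Y' ⊗ W)) ∘ unfold4 X X' Y Y' W.
Proof.
rewrite !unfold4E ichg_slide !tensmM1 -!compA.
rewrite (compk (assoc_nat_r _ _ _)) -!compA.
rewrite (compA (assoc (X ⊗ Y) _ _)) (compA (assoc X Y _)) pentagon_r -!compA.
rewrite (compk (assoc_nat_m _ _ _)) -!compA.
rewrite (compA (idm X ⊗₁ assoc _ _ _)) (compA (idm X ⊗₁ (_ ⊗₁ _))).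
rewrite -!tensm1M slide_whisker !tensm1M -!compA; congr (_ ∘ _).
rewrite [RHS](compk (assoc_nat_r _ _ _)) -!compA; congr (_ ∘ _).
exact: pentagon.
Qed.

Lemma ichg_nat X X' Y Y' A A' B B' (f : hom X A) (f' : hom X' A')
    (g : hom Y B) (g' : hom Y' B') :
  ichg A A' B B' ∘ ((f ⊗₁ f') ⊗₁ (g ⊗₁ g'))
  = ((f ⊗₁ g) ⊗₁ (f' ⊗₁ g')) ∘ ichg X X' Y Y'.
Proof.
rewrite !ichg_slide -!compA assoc_nat (compA (idm _ ⊗₁ _)) -tensmM.
rewrite slide_nat comp1m -{1}(compm1 f) tensmM !compA associ_nat.
by rewrite -!compA.
Qed.

Lemma unfold4_swaps X X' Y Y' W :
  unfold4 Y X Y' X' W ∘ ((swap X Y ⊗₁ swap X' Y') ⊗₁ idm W)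
  = slide X Y _ ∘ (idm X ⊗₁ (idm Y ⊗₁ slide X' Y' W)) ∘ unfold4 X Y X' Y' W.
Proof.
rewrite !unfold4E -!compA assoc_nat (compA (idm _ ⊗₁ _)) -tensmM comp1m.
rewrite -slide_assoc tensm_lr tensm1M -!compA.
rewrite (compA (assoc _ _ _)) -slide_assoc -!compA; congr (_ ∘ _).
by rewrite (compk (assoc_nat_r _ _ _)) -!compA.
Qed.

Lemma unfold4_swap X X' Y Y' W :
  unfold4 Y Y' X X' W ∘ (swap (X ⊗ X') (Y ⊗ Y') ⊗₁ idm W)
  = (idm Y ⊗₁ slide X Y' (X' ⊗ W)) ∘ slide X Y _
    ∘ (idm X ⊗₁ (idm Y ⊗₁ slide X' Y' W)) ∘ (idm X ⊗₁ slide X' Y _)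
    ∘ unfold4 X X' Y Y' W.
Proof.
rewrite !unfold4E -!compA -slide_assoc (compA (idm _ ⊗₁ _)) slide_tens_l.
rewrite -!compA (compk (slide_tens_r _ _ _ _)) -!compA.
do 2!congr (_ ∘ _).
rewrite (compA (idm X ⊗₁ _)) -tensm1M slide_tens_r !tensm1M -!compA.
by do 2!congr (_ ∘ _); rewrite [RHS](compk (assoc_nat_r _ _ _)) -!compA.
Qed.

Lemma ichg_swap X X' Y Y' :
  ichg Y Y' X X' ∘ swap (X ⊗ X') (Y ⊗ Y')
  = (swap X Y ⊗₁ swap X' Y') ∘ ichg X X' Y Y'.
Proof.
apply: whisker_r_inj; apply: unfold4_inj.
rewrite !tensmM1 (compk (ichg_whisker _ _ _ _ _)) -!compA unfold4_swap.
rewrite [RHS](compk (unfold4_swaps _ _ _ _ _)) -!compA ichg_whisker.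
by rewrite [LHS](compk (tensm_inv (comp1m _) (slideK _ _ _))) comp1m.
Qed.

Lemma ichg_assoc_tens A A' B B' C C' :
  (assoc A B C ⊗₁ assoc A' B' C') ∘ ichg (A ⊗ B) (A' ⊗ B') C C'
    ∘ (ichg A A' B B' ⊗₁ idm (C ⊗ C'))
  = ichg A A' (B ⊗ C) (B' ⊗ C')
    ∘ (idm (A ⊗ A') ⊗₁ ichg B B' C C')
    ∘ assoc (A ⊗ A') (B ⊗ B') (C ⊗ C').
Proof.
apply: (cancel_l (assocK _ _ _)).
apply: (cancel_l (tensm_inv (comp1m _) (assocK _ _ _))).
rewrite [in RHS](compk (ichg_assoc _ _ _ _)) -!compA.
rewrite [in RHS](compA (idm A ⊗₁ assoc _ _ _)) -tensm1M slide_tens_r.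
rewrite !tensm1M -!compA.
rewrite (compA (idm A ⊗₁ (idm A' ⊗₁ assoc B C _))) -assoc_nat_r -!compA.
rewrite [in RHS](compA (idm _ ⊗₁ assoc _ _ _)) -tensm1M ichg_assoc.
rewrite tensm1M -!compA [in RHS](compk (assoc_nat_r _ _ _)) -!compA.
rewrite [in RHS](compA (idm A ⊗₁ slide _ _ _)) -tensm1M slide_nat tensm1M -!compA.
rewrite -unfold4E.
rewrite -(ichg_whisker A A' B B' (C ⊗ C')) !unfold4E.
rewrite (tensm_lr (assoc A B C)) -!compA.
rewrite (compA (assoc A _ _)) (compA (idm A ⊗₁ _)) pentagon -!compA.
rewrite (compk (assoc_nat_r _ _ _)) -!compA.
rewrite (compk (ichg_assoc _ _ _ _)) -!compA.
rewrite (compA (idm (A ⊗ B) ⊗₁ (idm C ⊗₁ _))) -tensm1M slide_tens_l.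
rewrite !tensm1M -!compA (compk (assoc_nat_r _ _ _)) -!compA.
by rewrite (compk (assoc_nat_r _ _ _)) -!compA.
Qed.

Lemma ichg_lunit X X' :
  (lunit X ⊗₁ lunit X') ∘ ichg I I X X' ∘ (luniti I ⊗₁ idm _) = lunit (X ⊗ X').
Proof.
have lunit_associ Y Z : (lunit Y ⊗₁ idm Z) ∘ associ I Y Z = lunit (Y ⊗ Z).
  by rewrite -lunit_tens -compA associK compm1.
have slide_lunit W : (idm X ⊗₁ lunit W) ∘ slide I X W = lunit (X ⊗ W).
  rewrite slideE compA triangle compA -tensmM swap_runit comp1m.
  exact: lunit_associ.
rewrite ichg_slide (tensm_rl (lunit X)) -!compA (compk (lunit_associ _ _)).
rewrite (compk (lunit_nat _)) -compA (compk (slide_lunit _)).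
rewrite (compk (lunit_tens _ _)) (tensm_inv (lunitiK _) (comp1m _)) compm1 //.
Qed.

End Coherence.

Record MarkovCat := {
  mk_smc :> SymMonCat;
  del : forall X : mk_smc, hom X unit_ob;
  copy : forall X : mk_smc, hom X (X ⊗ X);
  del_uniq : forall (X : mk_smc) (f : hom X unit_ob), f = del X;
  copy_assoc : forall X : mk_smc,
    assoc X X X ∘ (copy X ⊗₁ idm X) ∘ copy X = (idm X ⊗₁ copy X) ∘ copy X;
  copy_lunit : forall X : mk_smc,
    lunit X ∘ (del X ⊗₁ idm X) ∘ copy X = idm X;
  copy_runit : forall X : mk_smc,
    runit X ∘ (idm X ⊗₁ del X) ∘ copy X = idm X;
  copy_swap : forall X : mk_smc, swap X X ∘ copy X = copy X;
  copy_tens : forall X Y : mk_smc,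
    copy (X ⊗ Y) = interchange X X Y Y ∘ (copy X ⊗₁ copy Y) }.

Arguments del {m} X.
Arguments copy {m} X.

Record MarkovIso (C D : MarkovCat) := {
  miso_fun : StrictSMFunctor C D;
  miso_inv : StrictSMFunctor D C;
  miso_funK : functor_eq (functor_comp miso_inv miso_fun) (functor_id C);
  miso_invK : functor_eq (functor_comp miso_fun miso_inv) (functor_id D);
  miso_copy : forall X : C,
    arr (fmap miso_fun (copy X)) = arr (copy (miso_fun X)) }.

Definition deterministic (C : MarkovCat) (X Y : C) (f : hom X Y) : Prop :=
  copy Y ∘ f = (f ⊗₁ f) ∘ copy X.

(** The projections that a terminal unit induces; in a [CartesianCat] they
    exhibit the given tensor product as a product. *)
Definition cfst_of (M : SymMonCat) (bang : forall X : M, hom X unit_ob) (X Y : M) :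
    hom (X ⊗ Y) X :=
  runit X ∘ (idm X ⊗₁ bang Y).

Definition csnd_of (M : SymMonCat) (bang : forall X : M, hom X unit_ob) (X Y : M) :
    hom (X ⊗ Y) Y :=
  lunit Y ∘ (bang X ⊗₁ idm Y).

Record CartesianCat := {
  cart_smc :> SymMonCat;
  bang : forall X : cart_smc, hom X unit_ob;
  pair : forall A X Y : cart_smc, hom A X -> hom A Y -> hom A (X ⊗ Y);
  bang_uniq : forall (X : cart_smc) (f : hom X unit_ob), f = bang X;
  fst_pair : forall (A X Y : cart_smc) (f : hom A X) (g : hom A Y),
    cfst_of bang X Y ∘ pair f g = f;
  snd_pair : forall (A X Y : cart_smc) (f : hom A X) (g : hom A Y),
    csnd_of bang X Y ∘ pair f g = g;
  pair_uniq : forall (A X Y : cart_smc) (h : hom A (X ⊗ Y)),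
    h = pair (cfst_of bang X Y ∘ h) (csnd_of bang X Y ∘ h) }.

Arguments bang {c} X.
Arguments pair {c A X Y} f g.

Section Deterministic.
Variable C : MarkovCat.
Implicit Types A W X Y Z : C.
Local Notation I := (@unit_ob C).

Lemma det_idm X : deterministic (idm X).
Proof. by rewrite /deterministic tensm1 comp1m compm1. Qed.

Lemma det_comp X Y Z (g : hom Y Z) (f : hom X Y) :
  deterministic g -> deterministic f -> deterministic (g ∘ f).
Proof.
by rewrite /deterministic => dg df; rewrite tensmM -compA -df !compA dg.
Qed.

Lemma det_inv X Y (f : hom X Y) (g : hom Y X) :
  deterministic f -> g ∘ f = idm X -> f ∘ g = idm Y -> deterministic g.
Proof.
rewrite /deterministic => df gf fg.
apply: (cancel_l (tensm_inv gf gf)); apply: (cancel_r fg).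
by rewrite -!compA gf compm1 (compk (tensm_inv fg fg)) comp1m -df.
Qed.

Lemma det_tensm X Y X' Y' (f : hom X X') (g : hom Y Y') :
  deterministic f -> deterministic g -> deterministic (f ⊗₁ g).
Proof.
rewrite /deterministic => df dg.
rewrite !copy_tens -!ichgE -compA -tensmM df dg tensmM !compA.
by rewrite ichg_nat.
Qed.

Lemma det_assoc X Y Z : deterministic (assoc X Y Z).
Proof.
rewrite /deterministic !copy_tens -!ichgE.
rewrite -[in LHS](comp1m (copy X)) -[in RHS](comp1m (copy Z)) !tensmM.
rewrite -!compA -assoc_nat.
have e := ichg_assoc_tens X X Y Y Z Z.
rewrite (compA (idm _ ⊗₁ _)).
by rewrite [LHS]compA -e -!compA.
Qed.

Lemma copy_unit : copy I = luniti I.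
Proof.
apply: (cancel_l (lunitK I)).
by rewrite [LHS]del_uniq [RHS]del_uniq.
Qed.

Lemma det_lunit X : deterministic (lunit X).
Proof.
rewrite /deterministic !copy_tens -!ichgE copy_unit -lunit_nat -ichg_lunit.
by rewrite -!compA -tensmM comp1m compm1.
Qed.

Lemma det_swap X Y : deterministic (swap X Y).
Proof.
by rewrite /deterministic !copy_tens -!ichgE -compA -swap_nat compA ichg_swap -compA.
Qed.

Lemma det_runit X : deterministic (runit X).
Proof. by rewrite -swap_lunit; apply/det_comp/det_swap/det_lunit. Qed.

Lemma det_del X : deterministic (del X).
Proof.
rewrite /deterministic copy_unit.
apply: (cancel_l (lunitK I)).
by rewrite [LHS]del_uniq [RHS]del_uniq.
Qed.

Lemma det_copy X : deterministic (copy X).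
Proof.
rewrite /deterministic copy_tens -ichgE -compA.
have copy3 : assoc X X (X ⊗ X) ∘ (copy X ⊗₁ copy X) ∘ copy X
    = (idm X ⊗₁ ((idm X ⊗₁ copy X) ∘ copy X)) ∘ copy X.
  rewrite (tensm_rl (copy X)) -compA (compk (assoc_nat_r _ _ _)) -compA.
  by rewrite copy_assoc compA -tensm1M.
apply: (cancel_l (assocK _ _ _)).
rewrite (compk (ichg_assoc _ _ _ _)) -compA copy3 compA -tensm1M.
rewrite -copy_assoc slideE -!compA (compk (assocK _ _ _)) comp1m.
by rewrite (compA (swap _ _ ⊗₁ _)) -tensmM1 copy_swap.
Qed.

Lemma sval_inj (T : Type) (P : T -> Prop) (u v : {x | P x}) :
  sval u = sval v -> u = v.
Proof. by case: u v => [x px] [y py] /= e; apply: subset_eq_compat. Qed.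

Definition det_cat : Category.
Proof.
refine (@Build_Category C (fun X Y => {f : hom X Y | deterministic f})
  (fun X => exist _ (idm X) (det_idm X))
  (fun X Y Z g f => exist _ (sval g ∘ sval f) (det_comp (svalP g) (svalP f)))
  _ _ _) => *; apply: sval_inj => /=.
- exact: comp1m.
- exact: compm1.
- exact: compA.
Defined.

Definition det_smc : SymMonCat.
Proof.
refine (@Build_SymMonCat det_cat I (fun X Y => X ⊗ Y)
  (fun X Y X' Y' f g => exist _ (sval f ⊗₁ sval g)
                                (det_tensm (svalP f) (svalP g)))
  (fun X Y Z => exist _ (assoc X Y Z) (det_assoc X Y Z))
  (fun X Y Z => exist _ (associ X Y Z)
    (det_inv (det_assoc X Y Z) (assocK X Y Z) (associK X Y Z)))
  (fun X => exist _ (lunit X) (det_lunit X))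
  (fun X => exist _ (luniti X) (det_inv (det_lunit X) (lunitK X) (lunitiK X)))
  (fun X => exist _ (runit X) (det_runit X))
  (fun X => exist _ (runiti X) (det_inv (det_runit X) (runitK X) (runitiK X)))
  (fun X Y => exist _ (swap X Y) (det_swap X Y))
  _ _ _ _ _ _ _ _ _ _ _ _ _ _ _ _) => *; apply: sval_inj => /=.
- exact: tensm1.
- exact: tensmM.
- exact: assocK.
- exact: associK.
- exact: lunitK.
- exact: lunitiK.
- exact: runitK.
- exact: runitiK.
- exact: swapK.
- exact: assoc_nat.
- exact: lunit_nat.
- exact: runit_nat.
- exact: swap_nat.
- exact: pentagon.
- exact: triangle.
- exact: hexagon.
Defined.

Lemma copy_runiti X : (idm X ⊗₁ del X) ∘ copy X = runiti X.
Proof. by apply: (cancel_l (runitK X)); rewrite runitiK copy_runit. Qed.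

Lemma copy_luniti X : (del X ⊗₁ idm X) ∘ copy X = luniti X.
Proof. by apply: (cancel_l (lunitK X)); rewrite lunitiK copy_lunit. Qed.

Lemma swap_unit : swap I I = idm (I ⊗ I).
Proof.
by apply: (cancel_l (lunitK I)); rewrite [LHS]del_uniq [RHS]del_uniq.
Qed.

Lemma ichg_unit X Y : ichg X I I Y = idm _.
Proof.
rewrite ichg_slide slideE swap_unit tensm1 comp1m associK tensm1 comp1m.
exact: assocK.
Qed.

Lemma proj_copy X Y :
  (cfst_of (@del C) X Y ⊗₁ csnd_of (@del C) X Y) ∘ copy (X ⊗ Y) = idm _.
Proof.
rewrite /cfst_of /csnd_of tensmM copy_tens -ichgE -compA.
rewrite (compA (_ ⊗₁ _) (ichg _ _ _ _)) -ichg_nat -compA -tensmM.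
rewrite copy_runiti copy_luniti ichg_unit comp1m.
exact: tensm_inv (runitiK X) (lunitiK Y).
Qed.

Definition det_cart : CartesianCat.
Proof.
refine (@Build_CartesianCat det_smc
  (fun X => exist _ (del X) (det_del X))
  (fun A X Y f g => exist _ ((sval f ⊗₁ sval g) ∘ copy A)
    (det_comp (det_tensm (svalP f) (svalP g)) (det_copy A)))
  _ _ _ _).
- by move=> X f; apply: sval_inj; apply: del_uniq.
- move=> A X Y f g; apply: sval_inj => /=.
  rewrite /cfst_of /= -compA (compA (_ ⊗₁ _) (_ ⊗₁ _)) -tensmM comp1m.
  rewrite [_ ∘ sval g]del_uniq tensm_lr -!compA copy_runiti.
  by rewrite (compk (runit_nat _)) -compA runitiK compm1.
- move=> A X Y f g; apply: sval_inj => /=.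
  rewrite /csnd_of /= -compA (compA (_ ⊗₁ _) (_ ⊗₁ _)) -tensmM comp1m.
  rewrite [_ ∘ sval f]del_uniq tensm_rl -!compA copy_luniti.
  by rewrite (compk (lunit_nat _)) -compA lunitiK compm1.
- move=> A X Y h; apply: sval_inj => /=.
  have dh : copy (X ⊗ Y) ∘ sval h = (sval h ⊗₁ sval h) ∘ copy A := svalP h.
  rewrite tensmM -compA -dh compA.
  by rewrite -[X in X ∘ _]/(_ ∘ copy (X ⊗ Y)) proj_copy comp1m.
Defined.

End Deterministic.

Definition det_incl (C : MarkovCat) : Functor (det_cart C) C.
Proof.
by refine (@Build_Functor (det_cart C) C (fun X => X) (fun X Y f => sval f) _ _).
Defined.

Definition is_distribution_object (C : MarkovCat) (X PX : C) (samp : hom PX X) :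
    Prop :=
  forall A : C, bijective (fun f : @hom (det_cart C) A PX => samp ∘ sval f).

Definition representable (C : MarkovCat) : Prop :=
  forall X : C, exists (PX : C) (samp : hom PX X), is_distribution_object samp.

Record Monad (D : Category) := {
  mnd_functor :> Functor D D;
  munit : forall X : D, hom X (mnd_functor X);
  mmult : forall X : D, hom (mnd_functor (mnd_functor X)) (mnd_functor X);
  munit_nat : forall (X Y : D) (f : hom X Y),
    munit Y ∘ f = fmap mnd_functor f ∘ munit X;
  mmult_nat : forall (X Y : D) (f : hom X Y),
    mmult Y ∘ fmap mnd_functor (fmap mnd_functor f)
    = fmap mnd_functor f ∘ mmult X;
  mmult_unitl : forall X : D, mmult X ∘ munit (mnd_functor X) = idm _;
  mmult_unitr : forall X : D,
    mmult X ∘ fmap mnd_functor (munit X) = idm (mnd_functor X);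
  mmult_assoc : forall X : D,
    mmult X ∘ mmult (mnd_functor X) = mmult X ∘ fmap mnd_functor (mmult X) }.

Record SymMonMonad (D : SymMonCat) := {
  smm_monad :> Monad D;
  nabla : forall X Y : D,
    hom (smm_monad X ⊗ smm_monad Y) (smm_monad (X ⊗ Y));
  nabla0 : hom unit_ob (smm_monad unit_ob);
  nabla_nat : forall (X Y X' Y' : D) (f : hom X X') (g : hom Y Y'),
    nabla X' Y' ∘ (fmap smm_monad f ⊗₁ fmap smm_monad g)
    = fmap smm_monad (f ⊗₁ g) ∘ nabla X Y;
  nabla_assoc : forall X Y Z : D,
    fmap smm_monad (assoc X Y Z) ∘ nabla (X ⊗ Y) Z ∘ (nabla X Y ⊗₁ idm _)
    = nabla X (Y ⊗ Z) ∘ (idm _ ⊗₁ nabla Y Z) ∘ assoc _ _ _;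
  nabla_lunit : forall X : D,
    fmap smm_monad (lunit X) ∘ nabla unit_ob X ∘ (nabla0 ⊗₁ idm _) = lunit _;
  nabla_runit : forall X : D,
    fmap smm_monad (runit X) ∘ nabla X unit_ob ∘ (idm _ ⊗₁ nabla0) = runit _;
  nabla_swap : forall X Y : D,
    fmap smm_monad (swap X Y) ∘ nabla X Y = nabla Y X ∘ swap _ _;
  munit_tens : forall X Y : D,
    nabla X Y ∘ (munit smm_monad X ⊗₁ munit smm_monad Y)
    = munit smm_monad (X ⊗ Y);
  munit_unit : nabla0 = munit smm_monad unit_ob;
  mmult_tens : forall X Y : D,
    mmult smm_monad (X ⊗ Y) ∘ fmap smm_monad (nabla X Y) ∘ nabla _ _
    = nabla X Y ∘ (mmult smm_monad X ⊗₁ mmult smm_monad Y);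
  mmult_unit : mmult smm_monad unit_ob ∘ fmap smm_monad nabla0 ∘ nabla0 = nabla0 }.

Definition affine (D : SymMonCat) (P : SymMonMonad D) : Prop :=
  isomorphic (P unit_ob) unit_ob.

Section Kleisli_category.
Variables (D : Category) (P : Monad D).
Local Notation δ := (munit P).
Local Notation E := (mmult P).

Definition kl_comp (X Y Z : D) (g : hom Y (P Z)) (f : hom X (P Y)) : hom X (P Z) :=
  E Z ∘ fmap P g ∘ f.

Lemma kl_compE X Y Z (g : hom Y (P Z)) (f : hom X (P Y)) :
  kl_comp g f = E Z ∘ fmap P g ∘ f.
Proof. by []. Qed.

Lemma kl_comp_pure_l X Y Z (g : hom Y Z) (f : hom X (P Y)) :
  kl_comp (δ Z ∘ g) f = fmap P g ∘ f.
Proof. by rewrite kl_compE fmapM -compA (compk (mmult_unitr _ _)) comp1m. Qed.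

Lemma kl_comp_pure_r X Y Z (g : hom Y (P Z)) (f : hom X Y) :
  kl_comp g (δ Y ∘ f) = g ∘ f.
Proof.
by rewrite kl_compE (compA (fmap P g)) -munit_nat -compA (compk (mmult_unitl _ _)) comp1m.
Qed.

Definition kl_cat : Category.
Proof.
refine (@Build_Category D (fun X Y => hom X (P Y)) δ kl_comp _ _ _).
- by move=> X Y f; rewrite -(compm1 (δ Y)) kl_comp_pure_l fmap1 comp1m.
- by move=> X Y f; rewrite -(compm1 (δ X)) kl_comp_pure_r compm1.
- move=> W X Y Z h g f; rewrite !kl_compE !fmapM -!compA.
  by rewrite (compA (fmap P h)) -mmult_nat !compA mmult_assoc.
Defined.

Definition kl_pure (X Y : D) (f : hom X Y) : @hom kl_cat X Y := δ Y ∘ f.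

Lemma kl_pure1 X : kl_pure (idm X) = @idm kl_cat X.
Proof. by rewrite /kl_pure compm1. Qed.

Lemma kl_pureM X Y Z (g : hom Y Z) (f : hom X Y) :
  @comp kl_cat _ _ _ (kl_pure g) (kl_pure f) = kl_pure (g ∘ f).
Proof. by rewrite /= kl_comp_pure_r /kl_pure compA. Qed.

Definition kl_incl : Functor D kl_cat.
Proof.
refine (@Build_Functor D kl_cat (fun X => X) kl_pure kl_pure1 _).
by move=> X Y Z g f; rewrite kl_pureM.
Defined.

End Kleisli_category.

Section Kleisli_smc.
Variables (D : SymMonCat) (P : SymMonMonad D).
Local Notation δ := (munit P).
Local Notation E := (mmult P).
Local Notation pure f := (kl_pure P f).

Definition kl_tensm (X Y X' Y' : D) (f : hom X (P X')) (g : hom Y (P Y')) :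
    hom (X ⊗ Y) (P (X' ⊗ Y')) :=
  nabla P X' Y' ∘ (f ⊗₁ g).

Lemma kl_tensm_pure (X Y X' Y' : D) (f : hom X X') (g : hom Y Y') :
  kl_tensm (pure f) (pure g) = pure (f ⊗₁ g).
Proof. by rewrite /kl_tensm /= tensmM compA munit_tens. Qed.

Definition kl_smc : SymMonCat.
Proof.
refine (@Build_SymMonCat (kl_cat P) (@unit_ob D) tens kl_tensm
  (fun X Y Z => pure (assoc X Y Z)) (fun X Y Z => pure (associ X Y Z))
  (fun X => pure (lunit X)) (fun X => pure (luniti X))
  (fun X => pure (runit X)) (fun X => pure (runiti X))
  (fun X Y => pure (swap X Y))
  _ _ _ _ _ _ _ _ _ _ _ _ _ _ _ _).
- by move=> X Y; rewrite /kl_tensm /= munit_tens.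
- move=> X Y X' Y' X'' Y'' g f g' f'; rewrite /kl_tensm /= !kl_compE.
  rewrite !tensmM (compA (nabla _ _ _)) -mmult_tens fmapM -!compA.
  by rewrite (compA (nabla _ _ _) (_ ⊗₁ _)) nabla_nat -!compA.
- by move=> X Y Z; rewrite kl_pureM assocK kl_pure1.
- by move=> X Y Z; rewrite kl_pureM associK kl_pure1.
- by move=> X; rewrite kl_pureM lunitK kl_pure1.
- by move=> X; rewrite kl_pureM lunitiK kl_pure1.
- by move=> X; rewrite kl_pureM runitK kl_pure1.
- by move=> X; rewrite kl_pureM runitiK kl_pure1.
- by move=> X Y; rewrite kl_pureM swapK kl_pure1.
- move=> X Y Z X' Y' Z' f g h; rewrite /= kl_comp_pure_l kl_comp_pure_r.
  rewrite /kl_tensm -{1}(@comp1m D _ _ h) -{2}(@comp1m D _ _ f) !tensmM.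
  have := nabla_assoc P X' Y' Z'; rewrite !compA => e.
  by rewrite -!compA -assoc_nat !compA e.
- move=> X Y f; rewrite /= kl_comp_pure_l kl_comp_pure_r /kl_tensm /=.
  by rewrite -munit_unit tensm_lr !compA -(compA (fmap P _)) nabla_lunit lunit_nat.
- move=> X Y f; rewrite /= kl_comp_pure_l kl_comp_pure_r /kl_tensm /=.
  by rewrite -munit_unit tensm_rl !compA -(compA (fmap P _)) nabla_runit runit_nat.
- move=> X Y X' Y' f g; rewrite /= kl_comp_pure_l kl_comp_pure_r /kl_tensm.
  by rewrite compA nabla_swap -!compA swap_nat.
- move=> W X Y Z.
  rewrite -!kl_pure1.
  by rewrite !kl_tensm_pure !kl_pureM pentagon.
- move=> X Y.
  rewrite -!kl_pure1.
  by rewrite !kl_tensm_pure !kl_pureM triangle.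
- move=> X Y Z.
  rewrite -!kl_pure1.
  by rewrite !kl_tensm_pure !kl_pureM hexagon.
Defined.

Lemma kl_smc_tensm (X Y X' Y' : D) (f : hom X X') (g : hom Y Y') :
  @tensm kl_smc _ _ _ _ (pure f) (pure g) = pure (f ⊗₁ g).
Proof. exact: kl_tensm_pure. Qed.

Lemma kl_interchange (X X' Y Y' : D) :
  @interchange kl_smc X X' Y Y' = pure (interchange X X' Y Y').
Proof.
rewrite [in RHS]/interchange -!kl_pureM -kl_tensm_pure -!kl_pureM.
by rewrite -kl_tensm_pure !kl_pure1.
Qed.

End Kleisli_smc.

Section Cartesian.
Variable D : CartesianCat.
Implicit Types A B W X Y Z : D.
Local Notation I := (@unit_ob D).

Definition diag X : hom X (X ⊗ X) := pair (idm X) (idm X).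

Definition cfst X Y : hom (X ⊗ Y) X := locked (cfst_of (@bang D) X Y).
Definition csnd X Y : hom (X ⊗ Y) Y := locked (csnd_of (@bang D) X Y).

Lemma cfstE X Y : cfst X Y = runit X ∘ (idm X ⊗₁ bang Y).
Proof. by rewrite /cfst -lock. Qed.

Lemma csndE X Y : csnd X Y = lunit Y ∘ (bang X ⊗₁ idm Y).
Proof. by rewrite /csnd -lock. Qed.

Lemma pair_ext A X Y (h k : hom A (X ⊗ Y)) :
  cfst X Y ∘ h = cfst X Y ∘ k -> csnd X Y ∘ h = csnd X Y ∘ k -> h = k.
Proof.
rewrite /cfst /csnd -!lock => e1 e2.
by rewrite (pair_uniq h) (pair_uniq k) e1 e2.
Qed.

Lemma bang_ext X (f g : hom X I) : f = g.
Proof. by rewrite (bang_uniq f) (bang_uniq g). Qed.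

Lemma cfst_diag X : cfst X X ∘ diag X = idm X.
Proof. by rewrite /cfst -lock fst_pair. Qed.

Lemma csnd_diag X : csnd X X ∘ diag X = idm X.
Proof. by rewrite /csnd -lock snd_pair. Qed.

Lemma cfst_tensm X Y X' Y' (f : hom X X') (g : hom Y Y') :
  cfst X' Y' ∘ (f ⊗₁ g) = f ∘ cfst X Y.
Proof.
rewrite !cfstE -compA -tensmM comp1m (bang_ext (_ ∘ g) (bang Y)) tensm_lr.
by rewrite compA runit_nat -compA.
Qed.

Lemma csnd_tensm X Y X' Y' (f : hom X X') (g : hom Y Y') :
  csnd X' Y' ∘ (f ⊗₁ g) = g ∘ csnd X Y.
Proof.
rewrite !csndE -compA -tensmM comp1m (bang_ext (_ ∘ f) (bang X)) tensm_rl.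
by rewrite compA lunit_nat -compA.
Qed.

Lemma cfst_swap X Y : cfst Y X ∘ swap X Y = csnd X Y.
Proof. by rewrite cfstE csndE -compA -swap_nat compA swap_runit. Qed.

Lemma csnd_swap X Y : csnd Y X ∘ swap X Y = cfst X Y.
Proof. by rewrite cfstE csndE -compA -swap_nat compA swap_lunit. Qed.

Lemma cfst_assoc X Y Z :
  cfst X (Y ⊗ Z) ∘ assoc X Y Z = cfst X Y ∘ cfst (X ⊗ Y) Z.
Proof.
rewrite !cfstE -!compA.
rewrite (bang_ext (bang (Y ⊗ Z)) (runit I ∘ (bang Y ⊗₁ bang Z))) tensm1M -compA.
rewrite -assoc_nat (compA (idm X ⊗₁ _)) runit_tens [in RHS]compA [in RHS]compA.
rewrite -runit_nat -!compA -tensmM compm1 comp1m compA.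
by rewrite -runit_nat -compA -tensmM comp1m.
Qed.

Lemma csnd_assoc X Y Z :
  csnd X (Y ⊗ Z) ∘ assoc X Y Z = csnd X Y ⊗₁ idm Z.
Proof.
rewrite !csndE -tensm1 -compA -assoc_nat compA lunit_tens.
by rewrite -tensmM comp1m.
Qed.

Lemma cfst_associ X Y Z :
  cfst (X ⊗ Y) Z ∘ associ X Y Z = idm X ⊗₁ cfst Y Z.
Proof.
apply: (cancel_r (associK X Y Z)); rewrite -compA assocK compm1.
apply: pair_ext.
  by rewrite compA cfst_tensm comp1m cfst_assoc.
by rewrite compA csnd_tensm -compA csnd_assoc cfst_tensm.
Qed.

Lemma csnd_associ X Y Z :
  csnd (X ⊗ Y) Z ∘ associ X Y Z = csnd Y Z ∘ csnd X (Y ⊗ Z).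
Proof.
apply: (cancel_r (associK X Y Z)); rewrite -!compA assocK compm1 csnd_assoc.
by rewrite csnd_tensm comp1m.
Qed.

Lemma diag_assoc X :
  assoc X X X ∘ (diag X ⊗₁ idm X) ∘ diag X = (idm X ⊗₁ diag X) ∘ diag X.
Proof.
apply: pair_ext.
  rewrite [LHS](compk (cfst_assoc _ _ _)) -!compA [in LHS](compA (cfst (X ⊗ X) X)).
  rewrite cfst_tensm [RHS](compk (cfst_tensm _ _)) -!compA cfst_diag.
  by rewrite compA cfst_diag comp1m.
rewrite [LHS](compk (csnd_assoc _ _ _)) [RHS](compk (csnd_tensm _ _)) -!compA.
rewrite (compA (csnd X X ⊗₁ _)) -tensmM csnd_diag comp1m tensm1.
by rewrite comp1m compm1.
Qed.

Lemma diag_swap X : swap X X ∘ diag X = diag X.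
Proof.
by apply: pair_ext; rewrite compA ?cfst_swap ?csnd_swap ?cfst_diag ?csnd_diag.
Qed.

Lemma diag_lunit X : lunit X ∘ (bang X ⊗₁ idm X) ∘ diag X = idm X.
Proof. by rewrite compA -csndE csnd_diag. Qed.

Lemma diag_runit X : runit X ∘ (idm X ⊗₁ bang X) ∘ diag X = idm X.
Proof. by rewrite compA -cfstE cfst_diag. Qed.

Lemma cfst_associ1 X Y Z :
  (cfst X Y ⊗₁ idm Z) ∘ associ X Y Z = idm X ⊗₁ csnd Y Z.
Proof.
apply: pair_ext.
  rewrite (compk (cfst_tensm _ _)) -compA cfst_associ !cfst_tensm.
  by [].
by rewrite (compk (csnd_tensm _ _)) comp1m csnd_associ csnd_tensm.
Qed.

Lemma cfst_slide X Y Z :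
  cfst Y (X ⊗ Z) ∘ slide X Y Z = cfst Y Z ∘ csnd X (Y ⊗ Z).
Proof.
rewrite slideE (compk (cfst_assoc _ _ _)) -compA (compk (cfst_tensm _ _)).
by rewrite -compA (compk (cfst_swap _ _)) cfst_associ csnd_tensm.
Qed.

Lemma csnd_slide X Y Z :
  csnd Y (X ⊗ Z) ∘ slide X Y Z = idm X ⊗₁ csnd Y Z.
Proof.
rewrite slideE (compk (csnd_assoc _ _ _)) compA -tensmM1 csnd_swap.
exact: cfst_associ1.
Qed.

Lemma cfst_ichg X X' Y Y' :
  cfst (X ⊗ Y) (X' ⊗ Y') ∘ ichg X X' Y Y' = cfst X X' ⊗₁ cfst Y Y'.
Proof.
rewrite ichg_slide (compk (cfst_associ _ _ _)) compA -tensm1M cfst_slide.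
rewrite tensm1M -cfst_associ1 -!compA assocK compm1.
by rewrite -tensm_rl.
Qed.

Lemma csnd_ichg X X' Y Y' :
  csnd (X ⊗ Y) (X' ⊗ Y') ∘ ichg X X' Y Y' = csnd X X' ⊗₁ csnd Y Y'.
Proof.
rewrite ichg_slide (compk (csnd_associ _ _ _)) -compA (compk (csnd_tensm _ _)).
by rewrite -compA csnd_assoc (compk (csnd_slide _ _ _)) -tensm_rl.
Qed.

Lemma diag_tens X Y :
  diag (X ⊗ Y) = interchange X X Y Y ∘ (diag X ⊗₁ diag Y).
Proof.
rewrite -ichgE; apply: pair_ext.
  by rewrite cfst_diag (compk (cfst_ichg _ _ _ _)) -tensmM !cfst_diag tensm1.
by rewrite csnd_diag (compk (csnd_ichg _ _ _ _)) -tensmM !csnd_diag tensm1.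
Qed.

End Cartesian.

Definition kl_markov (D : CartesianCat) (P : SymMonMonad D) (aff : affine P) :
  MarkovCat.
Proof.
refine (@Build_MarkovCat (kl_smc P)
  (fun X => kl_pure P (@bang D X)) (fun X => kl_pure P (@diag D X))
  _ _ _ _ _ _).
- move=> X f; case: aff => i [j [ij ji]].
  exact: (cancel_l ij (bang_ext _ _)).
- move=> X; rewrite -kl_pure1 !kl_smc_tensm !kl_pureM.
  by rewrite diag_assoc.
- move=> X; rewrite -kl_pure1 !kl_smc_tensm !kl_pureM.
  by rewrite diag_lunit.
- move=> X; rewrite -kl_pure1 !kl_smc_tensm !kl_pureM.
  by rewrite diag_runit.
- by move=> X; rewrite kl_pureM diag_swap.
- move=> X Y; rewrite kl_interchange kl_smc_tensm kl_pureM.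
  by rewrite diag_tens.
Defined.

Definition monad_square_pullback (D : CartesianCat) (P : SymMonMonad D) : Prop :=
  forall X : D,
    is_pullback (fmap P (pair (idm X) (idm X))) (nabla P X X)
      (munit P X) (pair (munit P X) (munit P X)).

(** [functor_eq] also compares domains and codomains, so that [F] is the
    identity on objects. *)
Definition extends_to_kleisli_iso (C : MarkovCat) (P : SymMonMonad (det_cart C))
    (aff : affine P) : Prop :=
  exists F : MarkovIso C (kl_markov aff),
    functor_eq (functor_comp (miso_fun F) (det_incl C)) (kl_incl P).

(* Main.v *)
From mathcomp Require Import ssreflect ssrfun ssrbool.
From Stdlib Require Import ProofIrrelevance IndefiniteDescription FunctionalExtensionality.
Require Import Defs.

(** If every [X] has a distribution object, write [sharp f] for the unique
    deterministic lift of [f] along [samp].  Then [P f := sharp (f ∘ samp)],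
    [δ := sharp id], [E := sharp (samp ∘ samp)] and [∇ := sharp (samp ⊗ samp)],
    and two deterministic maps into [P X] are equal as soon as they agree after
    [samp]; this proves all the monad laws, and [sharp] is the isomorphism onto
    the Kleisli category.  In the pullback condition, a cone [(a, b)] makes
    [samp ∘ a] deterministic: its copy is [(samp ⊗ samp) ∘ b], whose marginals
    force [b = (a, a)].  Conversely, [samp X] is the morphism of [C] that
    corresponds to [id : P X -> P X] viewed as a Kleisli morphism from [P X] to
    [X]. *)

Set Implicit Arguments.
Unset Strict Implicit.
Unset Printing Implicit Defensive.

Local Open Scope cat_scope.

(** * Choice of distribution objects *)

Record DistributionObject (C : MarkovCat) (X : C) := {
  dist_ob : C;
  samp_of : hom dist_ob X;
  sharp_of : forall A : C, hom A X -> @hom (det_cart C) A dist_ob;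
  sharp_ofK : forall (A : C) (f : hom A X), samp_of ∘ sval (sharp_of f) = f;
  samp_of_inj : forall (A : C) (f g : @hom (det_cart C) A dist_ob),
    samp_of ∘ sval f = samp_of ∘ sval g -> f = g }.

(** Passes from mere existence to data, so that lifts become a function. Bijectivity of sampling is
    stored as a section together with injectivity, the two forms in which it is used. [inhabited]
    keeps the result a proposition. *)
Lemma representable_choice (C : MarkovCat) :
  representable C -> inhabited (forall X : C, DistributionObject X).
Proof.
move=> repr; constructor=> X.
have [PX /constructive_indefinite_description[s sP]] :=
  constructive_indefinite_description _ (repr X).
(* [bijective] is recast as an [exists], from which an inverse can be chosen for every [A]. *)
have inv A : exists g : hom A X -> @hom (det_cart C) A PX,
    cancel (fun f => s ∘ sval f) g /\ cancel g (fun f => s ∘ sval f).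
  by case: (sP A) => g gK Kg; exists g.
pose g A := sval (constructive_indefinite_description _ (inv A)).
have gP A := svalP (constructive_indefinite_description _ (inv A)).
exists PX s g => A; first exact: (gP A).2.
exact: can_inj (gP A).1.
Qed.

Lemma fst_copy (C : MarkovCat) (X : C) : cfst_of (@del C) X X ∘ copy X = idm X.
Proof. by rewrite /cfst_of -compA copy_runit. Qed.

Lemma snd_copy (C : MarkovCat) (X : C) : csnd_of (@del C) X X ∘ copy X = idm X.
Proof. by rewrite /csnd_of -compA copy_lunit. Qed.

(** * The monad of distributions *)

Section Distribution_monad.
Variables (C : MarkovCat) (d : forall X : C, DistributionObject X).
Local Notation D := (det_cart C).
Implicit Types A X Y Z : C.

Definition dist X : C := dist_ob (d X).
Definition samp X : hom (dist X) X := samp_of (d X).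
Definition sharp A X (f : hom A X) : @hom D A (dist X) := sharp_of (d X) f.

Lemma samp_sharp A X (f : hom A X) : samp X ∘ sval (sharp f) = f.
Proof. exact: sharp_ofK. Qed.

Lemma samp_inj A X (f g : @hom D A (dist X)) :
  samp X ∘ sval f = samp X ∘ sval g -> f = g.
Proof. exact: samp_of_inj. Qed.

Definition dist_map X Y (f : @hom D X Y) : @hom D (dist X) (dist Y) :=
  sharp (sval f ∘ samp X).
Definition dist_unit X : @hom D X (dist X) := sharp (idm X).
Definition dist_mult X : @hom D (dist (dist X)) (dist X) :=
  sharp (samp X ∘ samp (dist X)).
Definition dist_nabla X Y : @hom D (dist X ⊗ dist Y) (dist (X ⊗ Y)) :=
  sharp (samp X ⊗₁ samp Y).

Lemma samp_map X Y (f : @hom D X Y) :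
  samp Y ∘ sval (dist_map f) = sval f ∘ samp X.
Proof. exact: samp_sharp. Qed.

Lemma samp_unit X : samp X ∘ sval (dist_unit X) = idm X.
Proof. exact: samp_sharp. Qed.

Lemma samp_mult X : samp X ∘ sval (dist_mult X) = samp X ∘ samp (dist X).
Proof. exact: samp_sharp. Qed.

Lemma samp_nabla X Y : samp (X ⊗ Y) ∘ sval (dist_nabla X Y) = samp X ⊗₁ samp Y.
Proof. exact: samp_sharp. Qed.

Lemma samp_unitk A X (f : hom A X) : samp X ∘ sval (dist_unit X) ∘ f = f.
Proof. by rewrite (compk (samp_unit X)) comp1m. Qed.

Definition dist_functor : Functor D D.
Proof.
refine (@Build_Functor D D dist dist_map _ _).
- move=> X; apply: samp_inj; rewrite samp_map /=.
  by rewrite comp1m compm1.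
- move=> X Y Z g f; apply: samp_inj; rewrite samp_map /=.
  by rewrite (compk (samp_map _)) -!compA samp_map.
Defined.

Definition dist_monad : Monad D.
Proof.
refine (@Build_Monad D dist_functor dist_unit dist_mult _ _ _ _ _).
- move=> X Y f; apply: samp_inj => /=.
  by rewrite samp_unitk (compk (samp_map _)) -compA samp_unit compm1.
- move=> X Y f; apply: samp_inj => /=.
  rewrite (compk (samp_mult _)) -compA samp_map (compk (samp_map _)).
  by rewrite [RHS](compk (samp_map _)) -!compA samp_mult.
- move=> X; apply: samp_inj => /=.
  by rewrite (compk (samp_mult _)) -compA samp_unit.
- move=> X; apply: samp_inj => /=.
  by rewrite (compk (samp_mult _)) -compA samp_map samp_unitk compm1.
- move=> X; apply: samp_inj => /=.
  rewrite (compk (samp_mult _)) -compA samp_mult.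
  by rewrite (compk (samp_mult _)) -[in RHS]compA samp_map (compk (samp_mult _)) compA.
Defined.

Definition dist_smm : SymMonMonad D.
Proof.
refine (@Build_SymMonMonad D dist_monad dist_nabla (dist_unit unit_ob)
  _ _ _ _ _ _ _ _ _).
- move=> X Y X' Y' f g; apply: samp_inj => /=.
  rewrite (compk (samp_nabla _ _)) -tensmM !samp_map tensmM.
  by rewrite (compk (samp_map _)) -compA samp_nabla.
- move=> X Y Z; apply: samp_inj => /=.
  rewrite (compk (samp_map _)) -!compA (compk (samp_nabla _ _)) -tensmM samp_nabla.
  rewrite (compk (samp_nabla _ _)) compA -tensmM samp_nabla !compm1.
  by rewrite assoc_nat.
- move=> X; apply: samp_inj => /=.
  rewrite (compk (samp_map _)) -!compA (compk (samp_nabla _ _)) -tensmM samp_unit.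
  by rewrite compm1 lunit_nat.
- move=> X; apply: samp_inj => /=.
  rewrite (compk (samp_map _)) -!compA (compk (samp_nabla _ _)) -tensmM samp_unit.
  by rewrite compm1 runit_nat.
- move=> X Y; apply: samp_inj => /=.
  rewrite (compk (samp_map _)) -!compA samp_nabla.
  by rewrite (compk (samp_nabla _ _)) swap_nat.
- move=> X Y; apply: samp_inj => /=.
  by rewrite (compk (samp_nabla _ _)) -tensmM !samp_unit tensm1.
(* The unit structure map was taken to be [dist_unit unit_ob]. *)
- exact: erefl.
- move=> X Y; apply: samp_inj => /=.
  rewrite (compk (samp_mult _)) -compA (compk (samp_map _)) -compA samp_nabla.
  rewrite (compk (samp_nabla _ _)) compA samp_nabla -!tensmM.
  by rewrite !samp_mult.
- apply: samp_inj => /=.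
  rewrite (compk (samp_mult _)) -compA (compk (samp_map _)) -compA samp_unit.
  by rewrite compm1 samp_unit.
Defined.

(** Deterministic maps into [dist unit_ob] are determined by their composites with [samp], and these
    end in the terminal object. *)
Lemma dist_affine : affine dist_smm.
Proof.
exists (@bang D (dist unit_ob)), (dist_unit unit_ob); split.
  by apply: samp_inj => /=; rewrite [LHS]del_uniq [RHS]del_uniq.
exact: bang_ext.
Qed.

Lemma dist_unit_det A X (f : @hom D A X) : dist_unit X ∘ f = sharp (sval f).
Proof. by apply: samp_inj; rewrite /= samp_unitk samp_sharp. Qed.

(** Discarding commutes with every morphism because [unit_ob] is terminal, so marginals may be taken
    before or after sampling, even though [samp] need not be deterministic. *)
Lemma samp_fst X Y :
  cfst_of (@del C) X Y ∘ (samp X ⊗₁ samp Y)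
  = samp X ∘ cfst_of (@del C) (dist X) (dist Y).
Proof.
rewrite /cfst_of -compA -tensmM comp1m [_ ∘ samp Y]del_uniq tensm_lr.
by rewrite compA runit_nat -compA.
Qed.

Lemma samp_snd X Y :
  csnd_of (@del C) X Y ∘ (samp X ⊗₁ samp Y)
  = samp Y ∘ csnd_of (@del C) (dist X) (dist Y).
Proof.
rewrite /csnd_of -compA -tensmM comp1m [_ ∘ samp X]del_uniq tensm_rl.
by rewrite compA lunit_nat -compA.
Qed.

Lemma dist_pullback : monad_square_pullback dist_smm.
Proof.
move=> X; split.
  apply: samp_inj => /=.
  rewrite (compk (samp_map _)) -compA samp_unit /=.
  rewrite (compk (samp_nabla _ _)) (compA (_ ⊗₁ _)) -tensmM samp_unit.
  by rewrite compm1 tensm1.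
move=> A a b /(f_equal (fun h => samp (X ⊗ X) ∘ sval h)) eab.
have ab : copy X ∘ samp X ∘ sval a = (samp X ⊗₁ samp X) ∘ sval b.
  move: eab; rewrite /= (compk (samp_map _)) (compk (samp_nabla _ _)) -compA /=.
  by rewrite tensm1 comp1m.
(* By [ab], sampling from either component of [b] amounts to sampling from [a] and keeping one of
   the two copies. *)
have a1 : @cfst_of D (@bang D) (dist X) (dist X) ∘ b = a.
  apply: samp_inj => /=.
  rewrite -[runit _ ∘ _]/(cfst_of (@del C) (dist X) (dist X)).
  rewrite compA -samp_fst -compA -ab.
  by rewrite (compk (fst_copy _)) comp1m.
have a2 : @csnd_of D (@bang D) (dist X) (dist X) ∘ b = a.
  apply: samp_inj => /=.
  rewrite -[lunit _ ∘ _]/(csnd_of (@del C) (dist X) (dist X)).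
  rewrite compA -samp_snd -compA -ab.
  by rewrite (compk (snd_copy _)) comp1m.
have eb : b = @pair D _ _ _ a a by rewrite (pair_uniq b) a1 a2.
have df : deterministic (samp X ∘ sval a).
  by rewrite /deterministic ab eb /= compA -tensmM.
pose f : @hom D A X := exist _ _ df.
have fa : dist_unit X ∘ f = a.
  by apply: samp_inj; rewrite /= samp_unitk.
(* Uniqueness: any mediating [u] satisfies [dist_unit X ∘ u = a], so sampling gives back [u]. *)
exists f; split; last first.
  move=> u [ua _]; apply: sval_inj => /=.
  by rewrite -ua /= samp_unitk.
(* The second leg is [(δ, δ) ∘ f = (δ ∘ f, δ ∘ f)], which unfolds to an instance of the determinism
   of [f]. *)
split=> //; rewrite eb -fa; apply: sval_inj => /=.
by rewrite -compA df compA -!tensmM.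
Qed.

(** * The isomorphism with the Kleisli category *)

Lemma sharp_comp X Y Z (g : hom Y Z) (f : hom X Y) :
  sharp (g ∘ f) = kl_comp (P := dist_monad) (sharp g) (sharp f).
Proof.
apply: samp_inj; rewrite samp_sharp /kl_comp /=.
rewrite (compk (samp_mult _)) -compA (compk (samp_map _)).
by rewrite -compA samp_sharp compA samp_sharp.
Qed.

Lemma sharp_tensm X Y X' Y' (f : hom X X') (g : hom Y Y') :
  sharp (f ⊗₁ g) = kl_tensm (P := dist_smm) (sharp f) (sharp g).
Proof.
apply: samp_inj; rewrite samp_sharp /kl_tensm /=.
by rewrite (compk (samp_nabla _ _)) -tensmM !samp_sharp.
Qed.

Lemma sharp_det X Y (f : @hom D X Y) : sharp (sval f) = kl_pure dist_monad f.
Proof. by rewrite -dist_unit_det. Qed.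

Lemma sharpK X Y (f : @hom D X (dist Y)) : sharp (samp Y ∘ sval f) = f.
Proof. by apply: samp_inj; rewrite samp_sharp. Qed.

Local Notation K := (kl_markov dist_affine).

Definition sharp_functor : Functor C K.
Proof.
refine (@Build_Functor C K (fun X => X) (fun X Y f => sharp f) _ _).
  by [].
exact: sharp_comp.
Defined.

Definition samp_functor : Functor K C.
Proof.
refine (@Build_Functor K C (fun X => X) (fun X Y f => samp Y ∘ sval f) _ _).
  exact: samp_unit.
move=> X Y Z g f.
(* Every Kleisli morphism is [sharp] of its sampled form, so functoriality is inherited from
   [sharp_comp]. *)
have -> : g ∘ f = sharp ((samp Z ∘ sval g) ∘ (samp Y ∘ sval f)).
  by rewrite sharp_comp !sharpK.
exact: samp_sharp.
Defined.

(** The coherence maps are deterministic, and on deterministic maps [sharp] is the canonical functor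
    [kl_pure], which defines the coherence maps of [K]. *)
Definition sharp_smf : StrictSMFunctor C K.
Proof.
apply: (@Build_StrictSMFunctor C K sharp_functor) => //= *; congr arr; first exact: sharp_tensm.
- exact: (sharp_det (@assoc D _ _ _)).
- exact: (sharp_det (@lunit D _)).
- exact: (sharp_det (@runit D _)).
- exact: (sharp_det (@swap D _ _)).
Defined.

Definition samp_smf : StrictSMFunctor K C.
Proof.
apply: (@Build_StrictSMFunctor K C samp_functor) => //= *; congr arr; try exact: samp_unitk.
by rewrite (compk (samp_nabla _ _)) -tensmM.
Defined.

Lemma dist_kleisli : extends_to_kleisli_iso dist_affine.
Proof.
have fK : functor_eq (functor_comp samp_smf sharp_smf) (functor_id C).
  by move=> X Y f; congr arr; exact: samp_sharp.
have Kf : functor_eq (functor_comp sharp_smf samp_smf) (functor_id K).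
  by move=> X Y f; congr arr; exact: sharpK.
have fcopy X : arr (fmap sharp_smf (copy X)) = arr (copy (sharp_smf X)).
  (* The diagonal of [D] unfolds to [(id ⊗ id) ∘ copy]. *)
  congr arr; apply: samp_inj; rewrite samp_sharp /= samp_unitk.
  by rewrite tensm1 comp1m.
exists (Build_MarkovIso fK Kf fcopy) => X Y f; congr arr.
exact: sharp_det.
Qed.

End Distribution_monad.

(** * From a Kleisli isomorphism back to representability *)

Lemma arr_inj (C : Category) (X Y : C) (f g : hom X Y) : arr f = arr g -> f = g.
(* The two dependent pairs, one for the domain and one for the codomain, are injective by proof
   irrelevance. *)
Proof. by case=> e; apply: (inj_pair2 _ _ _ _ _ (inj_pair2 _ _ _ _ _ e)). Qed.

Section Kleisli_representable.
Variables (C : MarkovCat) (P : SymMonMonad (det_cart C)).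
Local Notation K := (kl_cat P).

Lemma kleisli_iso_representable (F : Functor C K) (G : Functor K C) :
  functor_eq (functor_comp G F) (functor_id C) ->
  functor_eq (functor_comp F G) (functor_id K) ->
  functor_eq (functor_comp F (det_incl C)) (kl_incl P) ->
  representable C.
Proof.
(* The functors fix objects only up to a propositional equality. Taking them apart turns their
   object maps into variables, which [subst] replaces by the identity, so that no transports
   remain. *)
case: F G => [F0 F1 F1_id F1M] [G0 G1 G1_id G1M] GF FG Fdet.
have F0E : F0 = fun X => X.
  apply: functional_extensionality => X.
  by have := f_equal (@dom _) (Fdet X X (idm (X : det_cart C))).
have G0E : G0 = fun X => X.
  apply: functional_extensionality => X.
  by have := f_equal (@dom _) (GF X X (idm (X : C))); rewrite /= F0E.
subst F0 G0.
have GK (A X : C) (f : hom A X) : G1 A X (F1 A X f) = f := arr_inj (GF _ _ f).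
have FK (A X : C) (f : @hom K A X) : F1 A X (G1 A X f) = f := arr_inj (FG _ _ f).
move=> X; exists (P X), (G1 (P X) X (idm (P X : det_cart C))) => A.
(* On a deterministic [f], [F] gives [δ ∘ f], and the Kleisli composite of [id] with it is [f].
   Hence sampling after [f] is the action of [G] on [f] read as a Kleisli morphism from [A] to [X],
   and [F] inverts it. *)
have sampE (f : @hom (det_cart C) A (P X)) :
    G1 (P X) X (idm (P X : det_cart C)) ∘ sval f = G1 A X f.
  have fE : F1 A (P X) (sval f) = kl_pure P f := arr_inj (Fdet _ _ f).
  rewrite -(GK _ _ (sval f)) fE -G1M; congr (G1 _ _ _).
  exact: etrans (kl_comp_pure_r _ _) (comp1m _).
exists (F1 A X) => f; first by rewrite sampE FK.
by rewrite sampE GK.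
Qed.

End Kleisli_representable.

Theorem theorem3p19 (C : MarkovCat) :
  representable C <->
  exists (P : SymMonMonad (det_cart C)) (aff : affine P),
    monad_square_pullback P /\ extends_to_kleisli_iso aff.
Proof.
split=> [/representable_choice[d]|[P [aff [_ [F Fdet]]]]].
  exists (dist_smm d), (dist_affine d).
  by split; [exact: dist_pullback | exact: dist_kleisli].
exact: kleisli_iso_representable (miso_funK F) (miso_invK F) Fdet.
Qed.
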